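(* Let $P$ be the distribution of an exchangeable random network with $n$ nodes such that $\mathrm{sk}(P)=L^c_{-}(n)$, and consider some (distinct) nodes $i,j,k$. Let $C^d_{ijk}$ be the set of all dyads $lm$ with $l,m\notin\{i,j,k\}$. \begin{enumerate} \item Suppose that for every minimal $C$ such that $ij\perp\!\!\!\perp ik\mid C$, $C^d_{ijk}\subseteq C$ and $C$ is invariant under swapping $k$ and $m$ for every node $m$ for which there is a node $l$ such that $lm\notin C$. Then $P$ is faithful to $L^c_{-}(n)$ if and only if $P$ satisfies the intersection and composition properties. \item Suppose that for every maximal $C$ such that $ij\perp\!\!\!\perp ik\mid C$, $C^d_{ijk}\cap C=\varnothing$ and $C$ is invariant under swapping $k$ and $m$ for every node $m$ for which there is a node $l$ such that $lm\in C$. Then $P$ is faithful to $L^c_{\leftrightarrow}(n)$ if and only if $P$ satisfies the intersection and composition properties. \end{enumerate}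
   Context: Let $\mathcal N$ be a finite set of $n$ nodes and $\mathcal D$ the set of dyads, i.e. all two-element subsets of $\mathcal N$; the dyad $\{i,j\}$ is written $ij=ji$ (so writing $lm$ presupposes $l\ne m$). A random network is a family $X=(X_d)_{d\in\mathcal D}$ of $\{0,1\}$-valued random variables with joint distribution $P$. It is exchangeable if for every permutation $\pi$ of $\mathcal N$ and all values $x$, $P\{X_{ij}=x_{ij}\ \forall ij\in\mathcal D\}=P\{X_{ij}=x_{\pi(i)\pi(j)}\ \forall ij\in\mathcal D\}$. For pairwise disjoint $A,B,C\subseteq\mathcal D$, $A\perp\!\!\!\perp B\mid C$ denotes conditional independence of $X_A$ and $X_B$ given $X_C$ under $P$; single dyads are written without braces. $\mathrm{sk}(P)$ is the undirected graph on $\mathcal D$ in which distinct dyads $u,v$ are non-adjacent iff $u\perp\!\!\!\perp v\mid C$ for some $C\subseteq\mathcal D\setminus\{u,v\}$. The complement of the incidence graph on $n$ nodes has vertex set $\mathcal D$, with two distinct dyads adjacent iff they share no node; $L^c_{-}(n)$ is this graph with undirected edges and $L^c_{\leftrightarrow}(n)$ the same graph with bidirected edges. In an undirected graph, $A\perp_u B\mid C$ if every path between $A$ and $B$ has a vertex in $C$; in a bidirected graph, $A\perp_b B\mid C$ if every path between $A$ and $B$ has a vertex outside $A\cup B\cup C$. $P$ is faithful to an undirected (bidirected) graph if for all pairwise disjoint $A,B,C\subseteq\mathcal D$, $A\perp_u B\mid C$ (resp. $A\perp_b B\mid C$) holds iff $A\perp\!\!\!\perp B\mid C$. Intersection: for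 all pairwise disjoint $A,B,C,D\subseteq\mathcal D$, $A\perp\!\!\!\perp B\mid C\cup D$ and $A\perp\!\!\!\perp D\mid C\cup B$ imply $A\perp\!\!\!\perp B\cup D\mid C$. Composition: for all such sets, $A\perp\!\!\!\perp B\mid C$ and $A\perp\!\!\!\perp D\mid C$ imply $A\perp\!\!\!\perp B\cup D\mid C$. In a statement $u\perp\!\!\!\perp v\mid C$ with $C\subseteq\mathcal D\setminus\{u,v\}$, $C$ is minimal if the statement fails upon removal of any dyad from $C$, and maximal if it fails upon addition to $C$ of any dyad outside $C\cup\{u,v\}$. Swapping $k$ and $m$ is the node transposition $(k\,m)$ (identity if $m=k$); a node permutation $\pi$ acts on dyads by $ij\mapsto\pi(i)\pi(j)$ and a set of dyads is invariant if it is mapped onto itself. *)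

(* Defs.v *)
From HB Require Import structures.
From mathcomp Require Import all_boot all_order all_fingroup all_algebra.
From mathcomp Require Import reals.

Set Implicit Arguments.
Unset Strict Implicit.
Unset Printing Implicit Defensive.

Import Order.TTheory GRing.Theory Num.Theory.
Local Open Scope ring_scope.

Record dyad (N : finType) := Dyad {
  dyad_set :> {set N};
  card_dyad : #|dyad_set| == 2 }.

HB.instance Definition _ (N : finType) := [isSub for @dyad_set N].
HB.instance Definition _ (N : finType) := [Finite of dyad N by <:].

Lemma pair_card2 (N : finType) (i j : N) (h : i != j) : #|[set i; j]| == 2.
Proof. by rewrite cards2 h. Qed.

(* The dyad ij; its existence presupposes i != j. *)
Definition dyad_of (N : finType) (i j : N) (h : i != j) : dyad N :=
  Dyad (pair_card2 h).

Lemma perm_card2 (N : finType) (s : {perm N}) (d : dyad N) : #|s @: d| == 2.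
Proof. by rewrite card_imset ?card_dyad //; exact: perm_inj. Qed.

Definition dyad_perm (N : finType) (s : {perm N}) (d : dyad N) : dyad N :=
  Dyad (perm_card2 s d).

Definition network (N : finType) := {ffun dyad N -> bool}.

Section Distribution.
Variables (R : realType) (N : finType).
Implicit Types (P : network N -> R) (A B C D : {set dyad N}) (u v : dyad N).

(* The joint distribution of (X_d) is represented by its mass function. *)
Definition distribution P := (forall x, 0 <= P x) /\ \sum_x P x = 1.

Definition exchangeable P :=
  forall (s : {perm N}) (x : network N), P x = P [ffun d => x (dyad_perm s d)].

Definition prob P (E : {set network N}) : R := \sum_(x in E) P x.

Definition cond_prob P (E F : {set network N}) : R :=
  prob P (E :&: F) / prob P F.

(* The event X_A = x_A. *)
Definition agree A (x : network N) : {set network N} :=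
  [set y : network N | [forall d in A, y d == x d]].

(* X_A and X_B are conditionally independent given X_C. Only used for pairwise
   disjoint A, B, C, so that a single x carries arbitrary values of X_A, X_B
   and X_C. *)
Definition ci P A B C : bool :=
  [forall x : network N, (0 < prob P (agree C x)) ==>
    (cond_prob P (agree A x :&: agree B x) (agree C x) ==
     cond_prob P (agree A x) (agree C x) * cond_prob P (agree B x) (agree C x))].

Definition pairwise_disjoint (s : seq {set dyad N}) : bool :=
  pairwise (fun A B => [disjoint A & B]) s.

Definition intersection_property P :=
  forall A B C D, pairwise_disjoint [:: A; B; C; D] ->
    ci P A B (C :|: D) -> ci P A D (C :|: B) -> ci P A (B :|: D) C.

Definition composition_property P :=
  forall A B C D, pairwise_disjoint [:: A; B; C; D] ->
    ci P A B C -> ci P A D C -> ci P A (B :|: D) C.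

Definition skeleton P : rel (dyad N) := fun u v =>
  (u != v) && ~~ [exists C : {set dyad N},
                    [&& u \notin C, v \notin C & ci P [set u] [set v] C]].

Definition minimal_ci P u v C :=
  [/\ u \notin C, v \notin C, ci P [set u] [set v] C &
      forall d, d \in C -> ~~ ci P [set u] [set v] (C :\ d)].

Definition maximal_ci P u v C :=
  [/\ u \notin C, v \notin C, ci P [set u] [set v] C &
      forall d, d \notin C -> d != u -> d != v ->
        ~~ ci P [set u] [set v] (d |: C)].

(* A graph on the dyads is given by its adjacency relation G; whether its edges
   are undirected or bidirected is reflected in the separation criterion. *)
Definition undirected_sep (G : rel (dyad N)) A B C :=
  forall u p, path G u p -> uniq (u :: p) -> u \in A -> last u p \in B ->
    exists2 w, w \in u :: p & w \in C.

Definition bidirected_sep (G : rel (dyad N)) A B C :=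
  forall u p, path G u p -> uniq (u :: p) -> u \in A -> last u p \in B ->
    exists2 w, w \in u :: p & w \notin A :|: B :|: C.

Definition undirected_faithful P (G : rel (dyad N)) :=
  forall A B C, pairwise_disjoint [:: A; B; C] ->
    undirected_sep G A B C <-> ci P A B C.

Definition bidirected_faithful P (G : rel (dyad N)) :=
  forall A B C, pairwise_disjoint [:: A; B; C] ->
    bidirected_sep G A B C <-> ci P A B C.

End Distribution.

Definition incidence_compl (N : finType) : rel (dyad N) := fun u v =>
  (u != v) && [disjoint dyad_set u & dyad_set v].
Arguments incidence_compl : clear implicits.

Definition dyads_avoiding (N : finType) (i j k : N) : {set dyad N} :=
  [set d : dyad N | [disjoint dyad_set d & [set i; j; k]]].

Definition swap_invariant (N : finType) (k m : N) (C : {set dyad N}) :=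
  dyad_perm (tperm k m) @: C = C.

(* Main.v *)
Require Import Defs.
From HB Require Import structures.
From mathcomp Require Import all_boot all_order all_fingroup all_algebra.
From mathcomp Require Import reals.

Set Implicit Arguments.
Unset Strict Implicit.
Unset Printing Implicit Defensive.

Import Order.TTheory GRing.Theory Num.Theory.
Local Open Scope ring_scope.

(** Faithfulness implies intersection and composition because graph separation
    has both properties. The substance is the converse.

    The two criteria are one notion seen through a duality. Let [dual I A B C]
    be [I A B E] with [E] the complement of [A :|: B :|: C]. Duality exchanges
    decomposition with weak union and intersection with composition, and a
    path in which every vertex lies in [A :|: B :|: C] is one that avoids [E];
    hence bidirected faithfulness of [P] is undirected faithfulness of the dual
    of [ci P] ([bidirected_sepE], [dual_model], [dual_composition]).

    By composition, independence of sets reduces to independence of pairs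
    ([ind_pointwise]). Adjacent dyads are dependent given anything because of
    the skeleton, and by exchangeability all pairs of distinct dyads that share
    a node behave like [ij] and [ik]. So undirected faithfulness of a model [I]
    amounts to two facts about this one pair ([faithful_incidence_compl]):

    - a set [C] given which [ij] and [ik] are independent contains all dyads
      not inside some set [S] of at most four nodes. Among four nodes, disjoint
      dyads come in three separate edges, so that [ij] and [ik] are then
      separated by [C] ([not_reach_within]);
    - [ij] and [ik] are independent given all other dyads. Conversely to the
      first fact, this pairwise Markov property and intersection imply the
      independence of any two separated dyads ([pairwise_to_global] applied to
      the dual).

    The hypotheses on minimal and maximal sets leave very few of these. A
    minimal [C] consists of the dyads not inside some [S] with at most four
    nodes: the swaps force the non-neighbours of [k] in [C], viewed as a graph,
    to have the same neighbours as [k] ([minimal_shape]). This is the first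
    fact. For the second, exchangeability makes every pair of dyads of [S]
    sharing a node independent given [C], and [pairwise_to_global] lets
    composition add the rest of [S] to the conditioning set
    ([ind_given_rest]).

    Dually, a maximal [C] is complete on the closed neighbourhood of [k]
    ([maximal_shape]). As maximal sets are preserved by swapping [j] and [k],
    it is empty or complete on [S :\ i] for some [S] with [i], [j], [k] and at
    most one more node. The first fact for the dual follows at once. The second
    one asks for the marginal independence of [ij] and [ik], which is immediate
    when [C] is empty; otherwise composition and weak union along the star of
    [i] ([ind_given_rest_within]) reduce it to the dual of
    [ind_given_rest]. *)

(** * Set identities modulo disjointness *)

Lemma disjointPx (T : finType) (A B : {set T}) :
  reflect (forall x, (x \in A) && (x \in B) = false) [disjoint A & B].
Proof.
rewrite -setI_eq0; apply: (iffP eqP) => [AB0 x|AB0].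
  by rewrite -in_setI AB0 inE.
by apply/setP=> x; rewrite in_setI AB0 inE.
Qed.

Lemma subsetPx (T : finType) (A B : {set T}) :
  reflect (forall x, (x \in A) ==> (x \in B)) (A \subset B).
Proof.
by apply: (iffP subsetP) => sAB x; [apply/implyP/sAB | apply/implyP/sAB].
Qed.

Definition disjoint_sets (T : finType) (s : seq {set T}) : bool :=
  pairwise (fun A B : {set T} => [disjoint A & B]) s.

Ltac unpack_sets := repeat match goal with
  | H : is_true (disjoint_sets _) |- _ => rewrite /disjoint_sets /= in H
  | H : is_true (_ && _) |- _ => case/andP: H => ? ?
  | H : is_true (_ != _) |- _ => rewrite -in_set1 -disjoints1 in H
  | H : is_true (~~ (_ \in _)) |- _ => rewrite -disjoints1 in H
  end.

Ltac case_atoms := repeat match goal with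
  | |- context [?x \in ?A] => case: (x \in A)
  | |- context [?x == ?y] => case: (x == y)
  | |- context [?A \subset ?B] => case: (A \subset B)
  end.

Ltac pointwise x :=
  repeat match goal with
  | H : is_true [disjoint _ & _] |- _ => move/disjointPx/(_ x): H
  | H : is_true (_ \subset _) |- _ => move/subsetPx/(_ x): H
  end;
  rewrite ?inE; case_atoms; done.

(** Truth tables on the membership of a generic element; hypotheses of
    disjointness, inclusion and non-membership are instantiated at it. *)
Ltac set_tac :=
  unpack_sets; rewrite -?disjoints1;
  match goal with
  | |- _ = _ => let x := fresh "x" in apply/setP => x; pointwise x
  | |- is_true (disjoint_sets _) =>
      rewrite /disjoint_sets /=; repeat (apply/andP; split);
      try done; let x := fresh "x" in apply/disjointPx => x; pointwise x
  | |- is_true [disjoint _ & _] =>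
      let x := fresh "x" in apply/disjointPx => x; pointwise x
  | |- is_true (_ \subset _) =>
      let x := fresh "x" in apply/subsetPx => x; pointwise x
  end.

(** * Connectedness inside a set of vertices *)

Section Connectedness.
Variables (T : finType) (e : rel T).
Implicit Types (A B C D W : {set T}) (u v w : T).

Definition reach W : rel T :=
  connect [rel x y | [&& e x y, x \in W & y \in W]].

Definition separated A B C : bool :=
  [forall u in A, forall v in B, ~~ reach (~: C) u v].

Lemma separatedP A B C :
  reflect (forall u v, u \in A -> v \in B -> ~~ reach (~: C) u v)
          (separated A B C).
Proof.
apply: (iffP forall_inP) => [sep u v uA|sep u uA].
  by move/(forall_inP (sep u uA)).
by apply/forall_inP => v; apply: sep.
Qed.

Lemma reach_sub W W' u v : W \subset W' -> reach W u v -> reach W' u v.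
Proof.
move=> sWW'; apply: connect_sub => x y /and3P[exy xW yW].
by apply: connect1; rewrite /= exy !(subsetP sWW').
Qed.

Lemma reach_sym W : symmetric e -> symmetric (reach W).
Proof.
move=> e_sym; apply: sym_connect_sym => x y /=.
by rewrite e_sym [(x \in W) && _]andbC.
Qed.

Lemma reach1 W u v : e u v -> u \in W -> v \in W -> reach W u v.
Proof. by move=> euv uW vW; apply: connect1; rewrite /= euv uW. Qed.

Lemma reach_ind W (Q : T -> Prop) u v :
  Q u -> (forall x y, Q x -> e x y -> x \in W -> y \in W -> Q y) ->
  reach W u v -> Q v.
Proof.
move=> Qu Qstep /connectP[p + ->]; elim: p u Qu => [//|y p IHp] x Qx /=.
by case/andP=> /and3P[exy xW yW]; apply/IHp/(Qstep x).
Qed.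

Lemma reachP W u v : u \in W ->
  reflect (exists p, [/\ path e u p, uniq (u :: p), last u p = v &
                         {subset u :: p <= W}])
          (reach W u v).
Proof.
move=> uW; apply: (iffP idP) => [/connectP[p0 /shortenP[p ep up _] ->]|].
  exists p; split=> //; first by apply: sub_path ep => x y /and3P[].
  elim: p u uW {p0 up} ep => [|y p IHp] x xW /= => [_|/andP[/and3P[_ _ yW] ep]] z.
    by rewrite inE => /eqP->.
  by rewrite inE => /orP[/eqP->//|]; apply: IHp.
case=> p [ep _ <- sub]; elim: p u uW ep sub => [|y p IHp] x xW /=.
  by rewrite /reach connect0.
case/andP=> exy ep sub; have yW : y \in W by rewrite sub // !inE eqxx orbT.
apply: connect_trans (reach1 exy xW yW) (IHp y yW ep _) => z zp.
by apply: sub; rewrite inE zp orbT.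
Qed.

End Connectedness.

Section SeparationCriteria.
Variables (N : finType) (e : rel (dyad N)).
Implicit Types A B C : {set dyad N}.

Lemma undirected_sepE A B C : disjoint_sets [:: A; B; C] ->
  undirected_sep e A B C <-> separated e A B C.
Proof.
move=> dj; have AC u : u \in A -> u \in ~: C.
  have sAC : A \subset ~: C by set_tac.
  by move/(subsetP sAC).
split=> [sep|/separatedP sep u p ep up uA vB].
  apply/separatedP => u v uA vB; apply/(reachP _ _ (AC u uA)).
  case=> p [ep up vE sub]; rewrite -vE in vB.
  by have [w /sub] := sep u p ep up uA vB; rewrite inE => /negP.
apply/exists_inP; apply: (contraR _ (sep _ _ uA vB)) => nC.
apply/(reachP _ _ (AC u uA)); exists p; split=> // w wp.
by rewrite inE; apply: contra nC => wC; apply/exists_inP; exists w.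
Qed.

(** Asking for a vertex outside [A :|: B :|: C] is asking for a vertex in the
    complement of this set, so both criteria are the same notion of
    separation. *)
Lemma bidirected_sepE A B C :
  bidirected_sep e A B C <-> separated e A B (~: (A :|: B :|: C)).
Proof.
rewrite /separated setCK; set W := A :|: B :|: C.
have AW u : u \in A -> u \in W by rewrite !inE => ->.
split=> [sep|sep u p ep up uA vB].
  apply/forall_inP=> u uA; apply/forall_inP=> v vB.
  apply/(reachP _ _ (AW u uA)); case=> p [ep up vE sub]; rewrite -vE in vB.
  by have [w /sub ->] := sep u p ep up uA vB.
have /forall_inP/(_ u uA)/forall_inP/(_ _ vB) {}sep := sep.
apply/exists_inP; apply: (contraR _ sep) => nW.
apply/(reachP _ _ (AW u uA)); exists p; split=> // w wp.
by apply: contraR nW => wW; apply/exists_inP; exists w.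
Qed.

End SeparationCriteria.

(** * Compositional graphoids and their duals *)

Section Graphoids.
Variable T : finType.
Implicit Types (I : {set T} -> {set T} -> {set T} -> bool).
Implicit Types (A B C D Z : {set T}) (u v w : T) (e : rel T).

Definition intersective I := forall A B C D, disjoint_sets [:: A; B; C; D] ->
  I A B (C :|: D) -> I A D (C :|: B) -> I A (B :|: D) C.

Definition compositional I := forall A B C D, disjoint_sets [:: A; B; C; D] ->
  I A B C -> I A D C -> I A (B :|: D) C.

Definition faithful_to I e := forall A B C, disjoint_sets [:: A; B; C] ->
  separated e A B C <-> I A B C.

(** These rules, stated for disjoint sets only, form a self-dual fragment of the
    semi-graphoid axioms: duality exchanges decomposition and weak union. *)
Record independence_model I : Prop := IndependenceModel {
  ind_sym : forall A B C, disjoint_sets [:: A; B; C] -> I A B C -> I B A C;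
  ind_empty : forall A C, disjoint_sets [:: A; C] -> I A set0 C;
  ind_decomposition : forall A B C D, disjoint_sets [:: A; B; C; D] ->
    I A (B :|: D) C -> I A B C;
  ind_weak_union : forall A B C D, disjoint_sets [:: A; B; C; D] ->
    I A (B :|: D) C -> I A B (C :|: D) }.

Definition dual I A B C := I A B (~: (A :|: B :|: C)).

Lemma dual_model I : independence_model I -> independence_model (dual I).
Proof.
case=> sym empty dec wu; split; rewrite /dual.
- move=> A B C dj; rewrite [B :|: A]setUC; apply: sym; set_tac.
- move=> A C dj; apply: empty; set_tac.
- move=> A B C D dj /wu.
  have -> : ~: (A :|: B :|: C) = ~: (A :|: (B :|: D) :|: C) :|: D by set_tac.
  by apply; set_tac.
- move=> A B C D dj /dec.
  have -> : ~: (A :|: B :|: (C :|: D)) = ~: (A :|: (B :|: D) :|: C) by set_tac.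
  by apply; set_tac.
Qed.

(** With [E] the complement of [A :|: B :|: C :|: D], the premises of
    composition for the dual read [I A B (E :|: D)] and [I A D (E :|: B)],
    and the conclusion reads [I A (B :|: D) E]. *)
Lemma dual_composition I : intersective I <-> compositional (dual I).
Proof.
split=> H A B C D dj; last first.
  move: (H A B (~: (A :|: B :|: C :|: D)) D); rewrite /dual.
  have -> : ~: (A :|: B :|: ~: (A :|: B :|: C :|: D)) = C :|: D by set_tac.
  have -> : ~: (A :|: D :|: ~: (A :|: B :|: C :|: D)) = C :|: B by set_tac.
  have -> : ~: (A :|: (B :|: D) :|: ~: (A :|: B :|: C :|: D)) = C by set_tac.
  apply; set_tac.
move: (H A B (~: (A :|: B :|: C :|: D)) D); rewrite /dual.
have -> : ~: (A :|: B :|: C :|: D) :|: D = ~: (A :|: B :|: C) by set_tac.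
have -> : ~: (A :|: B :|: C :|: D) :|: B = ~: (A :|: D :|: C) by set_tac.
have -> : ~: (A :|: (B :|: D) :|: C) = ~: (A :|: B :|: C :|: D) by set_tac.
apply; set_tac.
Qed.

Lemma dual_intersection I : compositional I <-> intersective (dual I).
Proof.
split=> H A B C D dj; last first.
  move: (H A B (~: (A :|: B :|: C :|: D)) D); rewrite /dual.
  have -> : ~: (A :|: B :|: (~: (A :|: B :|: C :|: D) :|: D)) = C by set_tac.
  have -> : ~: (A :|: D :|: (~: (A :|: B :|: C :|: D) :|: B)) = C by set_tac.
  have -> : ~: (A :|: (B :|: D) :|: ~: (A :|: B :|: C :|: D)) = C by set_tac.
  apply; set_tac.
move: (H A B (~: (A :|: B :|: C :|: D)) D); rewrite /dual.
have -> : ~: (A :|: B :|: (C :|: D)) = ~: (A :|: B :|: C :|: D) by set_tac.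
have -> : ~: (A :|: D :|: (C :|: B)) = ~: (A :|: B :|: C :|: D) by set_tac.
have -> : ~: (A :|: (B :|: D) :|: C) = ~: (A :|: B :|: C :|: D) by set_tac.
apply; set_tac.
Qed.

Lemma faithful_composition I e : faithful_to I e -> compositional I.
Proof.
move=> fI A B C D dj /fI sAB /fI sAD; apply/fI; first by set_tac.
have /separatedP{}sAB : separated e A B C by apply: sAB; set_tac.
have /separatedP{}sAD : separated e A D C by apply: sAD; set_tac.
by apply/separatedP=> u v uA; rewrite inE => /orP[]; [apply: sAB|apply: sAD].
Qed.

Lemma faithful_intersection I e : faithful_to I e -> intersective I.
Proof.
move=> fI A B C D dj /fI sAB /fI sAD; apply/fI; first by set_tac.
have /separatedP{}sAB : separated e A B (C :|: D) by apply: sAB; set_tac.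
have /separatedP{}sAD : separated e A D (C :|: B) by apply: sAD; set_tac.
have ABD0 x : x \in A -> x \notin B :|: D.
  have : A \subset ~: (B :|: D) by set_tac.
  by move/subsetP=> sA /sA; rewrite inE.
have BD0 x : x \in B -> x \notin D.
  have : B \subset ~: D by set_tac.
  by move/subsetP=> sB /sB; rewrite inE.
apply/separatedP=> u v uA vBD; apply/negP.
(* A path from [A] that avoids [C] never enters [B :|: D]: its first vertex
   there would be reached without meeting [B] or [D] before. *)
pose Q x := x \notin B :|: D /\ reach e (~: (C :|: B :|: D)) u x.
have Qu : Q u by split; [apply: ABD0|apply: connect0].
suff Qstep x y : Q x -> e x y -> x \in ~: C -> y \in ~: C -> Q y.
  by move/(reach_ind Qu Qstep)=> [/negP].
case=> xBD ux exy xC yC.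
have xW : x \in ~: (C :|: B :|: D).
  by move: xC xBD; rewrite !inE !negb_or => ->.
have reachy (W : {set T}) : ~: (C :|: B :|: D) \subset W -> y \in W -> reach e W u y.
  move=> sW yW; apply: connect_trans (reach_sub sW ux) (reach1 exy _ yW).
  exact: (subsetP sW).
have yB : y \notin B.
  apply/negP => yB; have /negP[] := sAB u y uA yB; apply: reachy.
    by set_tac.
  by move: yC (BD0 _ yB); rewrite !inE negb_or => ->.
have yD : y \notin D.
  apply/negP => yD; have /negP[] := sAD u y uA yD; apply: reachy.
    by set_tac.
  by move: yC yB; rewrite !inE negb_or => ->.
split; first by rewrite inE negb_or yB.
by apply: reachy => //; move: yC; rewrite !inE !negb_or yB yD => ->.
Qed.

Section Composition.
Variable I : {set T} -> {set T} -> {set T} -> bool.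
Hypotheses (modI : independence_model I) (compI : compositional I).

(** Composition assembles a set from its elements, one side at a time;
    decomposition takes it apart. *)
Lemma ind_pointwise A B C : disjoint_sets [:: A; B; C] ->
  I A B C <-> (forall u v, u \in A -> v \in B -> I [set u] [set v] C).
Proof.
have right A' B' C' : disjoint_sets [:: A'; B'; C'] ->
    I A' B' C' <-> (forall v, v \in B' -> I A' [set v] C').
  move=> dj; split=> [+ v vB|].
    have sv : [set v] \subset B' by rewrite sub1set.
    rewrite -(setD1K vB); apply: (ind_decomposition modI); set_tac.
  have [m] := ubnP #|B'|; elim: m B' dj => // m IHm B' dj leBm IB.
  have [->|[v vB]] := set_0Vmem B'.
    by apply: (ind_empty modI); set_tac.
  have sv : [set v] \subset B' by rewrite sub1set.
  rewrite -(setD1K vB); apply: compI; first by set_tac.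
    exact: IB.
  apply: IHm; first by set_tac.
    by move: leBm; rewrite (cardsD1 v) vB.
  by move=> w /setD1P[_]; apply: IB.
move=> dj; rewrite right //; split=> [IAB u v uA vB|IAB v vB].
  have su : [set u] \subset A by rewrite sub1set.
  have sv : [set v] \subset B by rewrite sub1set.
  apply: (ind_sym modI); first by set_tac.
  have [|+ _] := right [set v] A C; first by set_tac.
  by apply=> //; apply: (ind_sym modI); [set_tac|exact: IAB].
have sv : [set v] \subset B by rewrite sub1set.
apply: (ind_sym modI); first by set_tac.
apply/right; first by set_tac.
move=> u uA; have su : [set u] \subset A by rewrite sub1set.
by apply: (ind_sym modI); [set_tac|exact: IAB].
Qed.

Lemma ind_add1 Z u v w : disjoint_sets [:: [set u]; [set v]; Z; [set w]] ->
  I [set u] [set v] Z -> I [set u] [set w] Z -> I [set u] [set v] (Z :|: [set w]).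
Proof. by move=> dj uv uw; apply: (ind_weak_union modI) => //; apply: compI. Qed.

(** Read in the graph restricted to the complement of [Z]. Grow the conditioning
    set from [Z] to [C] one vertex [w] at a time: as [u] and [v] are not
    connected, [w] is disconnected from one of them, say from [u], so that
    composition gives independence of [u] from both [v] and [w], and weak union
    moves [w] to the conditioning side. *)
Lemma pairwise_to_global e Z C u v : symmetric e ->
  (forall x y, x != y -> x \notin Z -> y \notin Z -> ~~ e x y ->
     I [set x] [set y] Z) ->
  u != v -> u \notin C -> v \notin C -> Z \subset C ->
  ~~ reach e ((C :\: Z) :|: [set u; v]) u v -> I [set u] [set v] C.
Proof.
move=> e_sym pwI; have [m] := ubnP #|C :\: Z|.
elim: m C u v => // m IHm C u v leCm uv uC vC sZC nuv.
have [CZ0|[w wCZ]] := set_0Vmem (C :\: Z).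
  have CZ : C = Z.
    by apply/eqP; rewrite eqEsubset sZC andbT -setD_eq0 CZ0.
  rewrite CZ in uC vC *; apply: pwI => //; apply: contra nuv => euv.
  by apply: reach1; rewrite // !inE eqxx ?orbT.
have /andP[wZ wC] : (w \notin Z) && (w \in C) by rewrite -in_setD.
have sw : [set w] \subset C :\: Z by rewrite sub1set.
have eC : C = (C :\ w) :|: [set w] by rewrite setUC setD1K.
have uw : u != w by apply: contraNneq uC => ->.
have vw : v != w by apply: contraNneq vC => ->.
have IH x y : x \in [set u; v; w] -> y \in [set u; v; w] -> x != y ->
    x \notin C :\ w -> y \notin C :\ w ->
    ~~ reach e ((C :\: Z) :|: [set u; v]) x y -> I [set x] [set y] (C :\ w).
  move=> xW yW xy xC yC nxy; apply: IHm => //; last first.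
  - apply: contra nxy; apply: reach_sub.
    have sx : [set x] \subset [set u; v; w] by rewrite sub1set.
    have sy : [set y] \subset [set u; v; w] by rewrite sub1set.
    set_tac.
  - by rewrite subsetD1 sZC.
  - rewrite -ltnS; apply: leq_trans leCm; rewrite ltnS; apply: proper_card.
    rewrite properE; apply/andP; split; first by set_tac.
    by apply/subsetPn; exists w; rewrite // !inE eqxx andbF.
have inW : (u \in [set u; v; w]) * (v \in [set u; v; w]) * (w \in [set u; v; w]).
  by rewrite !inE !eqxx !orbT.
have nCw : (u \notin C :\ w) * (v \notin C :\ w) * (w \notin C :\ w).
  by rewrite !inE eqxx (negPf uC) (negPf vC) !andbF.
have Iuv : I [set u] [set v] (C :\ w) by apply: IH; rewrite ?inW ?nCw.
(* [w] lies outside the component of [u] or outside that of [v]. *)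
have [uw_conn|nuw] := boolP (reach e (C :\: Z :|: [set u; v]) u w); last first.
  rewrite eC; apply: ind_add1 => //; first by set_tac.
  by apply: IH; rewrite ?inW ?nCw.
have nvw : ~~ reach e (C :\: Z :|: [set u; v]) v w.
  apply: contra nuv => vw_conn; apply: connect_trans uw_conn _.
  by have := vw_conn; rewrite reach_sym.
apply: (ind_sym modI); first by set_tac.
rewrite eC; apply: ind_add1; first by set_tac.
  by apply: (ind_sym modI) => //; set_tac.
by apply: IH; rewrite ?inW ?nCw.
Qed.

End Composition.

End Graphoids.

(** * Permutations of the nodes acting on dyads *)

Section DyadPermutations.
Variable N : finType.
Implicit Types (s t : {perm N}) (a b c : N) (S : {set N}).
Implicit Types (d u v : dyad N) (A B C : {set dyad N}).

Lemma dyad_permM s t d : dyad_perm s (dyad_perm t d) = dyad_perm (t * s)%g d.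
Proof.
by apply: val_inj; rewrite /= -imset_comp; apply: eq_imset => a /=; rewrite permM.
Qed.

Lemma dyad_perm1 d : dyad_perm 1%g d = d.
Proof. by apply: val_inj; rewrite /= (eq_imset _ (@perm1 N)) imset_id. Qed.

Lemma dyad_permK s : cancel (dyad_perm s) (dyad_perm s^-1%g).
Proof. by move=> d; rewrite dyad_permM mulgV dyad_perm1. Qed.

Lemma dyad_permKV s : cancel (dyad_perm s^-1%g) (dyad_perm s).
Proof. by move=> d; rewrite dyad_permM mulVg dyad_perm1. Qed.

Lemma dyad_perm_of s a b (hab : a != b) (hsab : s a != s b) :
  dyad_perm s (dyad_of hab) = dyad_of hsab.
Proof. by apply: val_inj; rewrite /= imsetU1 imset_set1. Qed.

Lemma dyad_permC s A : dyad_perm s @: (~: A) = ~: (dyad_perm s @: A).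
Proof.
by rewrite !(can_imset_pre _ (dyad_permK s)) preimsetC.
Qed.

Lemma dyadP d : exists a b (hab : a != b), d = dyad_of hab.
Proof.
have /cards2P[a [b [hab dE]]] := card_dyad d.
exists a, b, hab; exact: val_inj.
Qed.

Lemma sharing_dyads u v : u != v -> ~~ incidence_compl N u v ->
  exists a b c (hab : a != b) (hac : a != c),
    [/\ b != c, u = dyad_of hab & v = dyad_of hac].
Proof.
move=> uv; rewrite /incidence_compl uv /= => /pred0Pn[a /andP[/= au av]].
have other d : a \in dyad_set d -> exists b (hab : a != b), d = dyad_of hab.
  have [b [c [hbc ->]]] := dyadP d; rewrite /= !inE => /orP[]/eqP aE.
    by rewrite aE; exists c, hbc.
  have hcb : c != b by rewrite eq_sym.
  by rewrite aE; exists b, hcb; apply: val_inj; rewrite /= setUC.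
have [b [hab uE]] := other u au; have [c [hac vE]] := other v av.
exists a, b, c, hab, hac; split=> //; apply: contraNneq uv => bc.
by apply/eqP; rewrite uE vE; apply: val_inj; rewrite /= bc.
Qed.

(** Three transpositions inside [S], each putting one node in place without
    moving those already placed. *)
Lemma perm_on3 S i j k a b c : i != j -> i != k -> j != k ->
    a != b -> a != c -> b != c ->
    [set i; j; k] \subset S -> [set a; b; c] \subset S ->
  exists s : {perm N}, [/\ perm_on S s, s i = a, s j = b & s k = c].
Proof.
move=> ij ik jk ab ac bc /subsetP sijk /subsetP sabc.
have [iS jS kS] : [/\ i \in S, j \in S & k \in S].
  by split; apply: sijk; rewrite !inE eqxx ?orbT.
have [aS bS cS] : [/\ a \in S, b \in S & c \in S].
  by split; apply: sabc; rewrite !inE eqxx ?orbT.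
have on_tperm x y : x \in S -> y \in S -> perm_on S (tperm x y).
  move=> xS yS; apply: subset_trans (tperm_on x y) _.
  by apply/subsetP=> z; rewrite !inE => /orP[]/eqP->.
pose s1 := tperm i a; pose s2 := (s1 * tperm (s1 j) b)%g.
pose s3 := (s2 * tperm (s2 k) c)%g.
have on1 : perm_on S s1 by apply: on_tperm.
have on2 : perm_on S s2 by rewrite perm_onM // on_tperm // perm_closed.
have on3 : perm_on S s3 by rewrite perm_onM // on_tperm // perm_closed.
have s1i : s1 i = a by rewrite tpermL.
have s2j : s2 j = b by rewrite permM tpermL.
have s2i : s2 i = a.
  by rewrite permM s1i tpermD // 1?eq_sym // -s1i (inj_eq perm_inj).
exists s3; split=> //.
- by rewrite permM s2i tpermD // 1?eq_sym // -s2i (inj_eq perm_inj).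
- by rewrite permM s2j tpermD // 1?eq_sym // -s2j (inj_eq perm_inj).
- by rewrite permM tpermL.
Qed.

Definition dyads_within S : {set dyad N} := [set d | dyad_set d \subset S].

Lemma within_dyad_of S a b (hab : a != b) :
  (dyad_of hab \in dyads_within S) = (a \in S) && (b \in S).
Proof. by rewrite inE subUset !sub1set. Qed.

Lemma dyads_within_perm S s :
  dyad_perm s @: dyads_within S = dyads_within (s @: S).
Proof.
apply/setP=> d; rewrite (can_imset_pre _ (dyad_permK s)) !inE /=.
by rewrite (can_imset_pre S (permK s)) sub_imset_pre.
Qed.

Definition perm_invariant (I : {set dyad N} -> {set dyad N} -> {set dyad N} -> bool) :=
  forall s A B C, I A B C ->
    I (dyad_perm s @: A) (dyad_perm s @: B) (dyad_perm s @: C).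

Lemma dual_perm_invariant I : perm_invariant I -> perm_invariant (dual I).
Proof.
by move=> invI s A B C; rewrite /dual -!imsetU -dyad_permC; apply: invI.
Qed.

End DyadPermutations.

(** * Conditional independence of the entries of a network *)

Section ConditionalIndependence.
Variables (R : realType) (N : finType) (P : network N -> R).
Hypothesis P_ge0 : forall x, 0 <= P x.
Implicit Types (A B C D S : {set dyad N}) (d u v : dyad N) (x y : network N).

Definition margin S x : R := prob P (agree S x).

Lemma agreeE S x y : (y \in agree S x) = [forall d in S, y d == x d].
Proof. by rewrite inE. Qed.

Lemma agreeU A B x : agree (A :|: B) x = agree A x :&: agree B x.
Proof.
apply/setP=> y; rewrite in_setI !agreeE; apply/forall_inP/andP => [xy|].
  by split; apply/forall_inP=> d dS; apply: xy; rewrite inE dS ?orbT.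
by case=> /forall_inP xyA /forall_inP xyB d /setUP[/xyA|/xyB].
Qed.

Lemma eq_margin S x y : {in S, x =1 y} -> margin S x = margin S y.
Proof.
move=> exy; congr prob; apply/setP=> z; rewrite !agreeE.
by apply: eq_forallb_in => d /exy ->.
Qed.

Lemma prob_ge0 E : 0 <= prob P E.
Proof. exact: sumr_ge0. Qed.

Lemma margin_eq0 A B x : A \subset B -> margin A x = 0 -> margin B x = 0.
Proof.
move=> sAB mA0; apply/eqP; rewrite eq_le prob_ge0 andbT -mA0 /margin.
rewrite -(setUidPr sAB) agreeU /prob [leRHS](big_setID (agree B x)) /= lerDl.
exact: sumr_ge0.
Qed.

Lemma cond_probE A C x :
  cond_prob P (agree A x) (agree C x) = margin (A :|: C) x / margin C x.
Proof. by rewrite /cond_prob -agreeU. Qed.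

(** The product form avoids division, and it holds trivially where the
    conditioning event is null. *)
Lemma ciP A B C :
  reflect (forall x, margin (A :|: B :|: C) x * margin C x =
                     margin (A :|: C) x * margin (B :|: C) x)
          (ci P A B C).
Proof.
apply: (iffP forallP) => ciABC x; have := ciABC x.
  rewrite -agreeU !cond_probE.
  have [C0|C_neq0] := eqVneq (margin C x) 0.
    by move=> _; rewrite C0 (margin_eq0 (subsetUr A C) C0) mulr0 mul0r.
  rewrite lt_neqAle eq_sym C_neq0 prob_ge0 /= => /eqP eqx.
  rewrite -[margin (A :|: B :|: C) x](divfK C_neq0) eqx mulf_div.
  by rewrite -[LHS]mulrA divfK // mulf_neq0.
move=> eqx; apply/implyP=> C_gt0; have C_neq0 := lt0r_neq0 C_gt0.
rewrite -agreeU !cond_probE mulrACA -eqx -invfM; apply/eqP.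
by rewrite invfM mulrA mulfK.
Qed.

Definition upd x d b : network N := [ffun e => if e == d then b else x e].

Lemma margin_upd S x d b : d \notin S -> margin S (upd x d b) = margin S x.
Proof.
by move=> dS; apply: eq_margin => e eS; rewrite ffunE (negPf (memPn dS _ eS)).
Qed.

Lemma margin_split S x d : d \notin S ->
  margin S x = \sum_b margin (S :|: [set d]) (upd x d b).
Proof.
move=> dS; rewrite /margin /prob (partition_big (fun y => y d) predT) //=.
apply: eq_bigr => b _; apply: eq_bigl => y; rewrite agreeU in_setI; congr (_ && _).
  rewrite !agreeE; apply: eq_forallb_in => e eS.
  by rewrite ffunE (negPf (memPn dS _ eS)).
rewrite agreeE; apply/idP/forall_inP => [yd e /set1P->|/(_ d (set11 d))].
  by rewrite ffunE eqxx.
by rewrite ffunE eqxx.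
Qed.

(** Sum the product form over the two values of [X_d], on which neither
    [margin C] nor [margin (A :|: C)] depends. *)
Lemma ci_decomposition1 A B C d : disjoint_sets [:: A; B; C; [set d]] ->
  ci P A (B :|: [set d]) C -> ci P A B C.
Proof.
move=> dj /ciP ciA; apply/ciP => x.
have dAC : d \notin A :|: C by set_tac.
have dBC : d \notin B :|: C by set_tac.
have dC : d \notin C by set_tac.
have dABC : d \notin A :|: B :|: C by set_tac.
rewrite (margin_split _ dABC) (margin_split _ dBC) mulr_suml mulr_sumr.
apply: eq_bigr => b _.
rewrite -(margin_upd x b dC) -(margin_upd x b dAC) setUAC [B :|: C :|: _]setUAC.
by rewrite -ciA -setUA [_ :|: [set d]]setUC !setUA; congr (margin _ _ * _); set_tac.
Qed.

Lemma ci_decomposition A B C D : disjoint_sets [:: A; B; C; D] ->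
  ci P A (B :|: D) C -> ci P A B C.
Proof.
have [m] := ubnP #|D|; elim: m D => // m IHm D leDm dj.
have [->|[d dD]] := set_0Vmem D; first by rewrite setU0.
have sd : [set d] \subset D by rewrite sub1set.
rewrite -[in B :|: D](setD1K dD) [d |: _]setUC setUA => /ci_decomposition1 ciD.
apply: (IHm (D :\ d)); first by move: leDm; rewrite (cardsD1 d) dD.
  by set_tac.
by apply: ciD; set_tac.
Qed.

Lemma ci_model : independence_model (ci P).
Proof.
split.
- move=> A B C dj /ciP ciAB; apply/ciP => x.
  by rewrite [B :|: A]setUC ciAB mulrC.
- by move=> A C dj; apply/ciP => x; rewrite setU0 set0U.
- exact: ci_decomposition.
move=> A B C D dj ciABD; apply/ciP => x.
have /ciP/(_ x) ciAD : ci P A D C.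
  by apply: (@ci_decomposition _ _ _ B); [set_tac | rewrite setUC].
have {ciABD}/ciP/(_ x) := ciABD; rewrite !setUA.
have -> : A :|: B :|: D :|: C = A :|: B :|: C :|: D by set_tac.
have -> : B :|: D :|: C = B :|: C :|: D by set_tac.
move: ciAD; have -> : A :|: D :|: C = A :|: C :|: D by set_tac.
rewrite [D :|: C]setUC; have [C0 _ _|C_neq0 eAD eABD] := eqVneq (margin C x) 0.
  rewrite [margin (C :|: D) x](margin_eq0 _ C0) ?subsetUl //.
  rewrite [margin (B :|: C :|: D) x](margin_eq0 _ C0) ?mulr0 //.
  by set_tac.
apply: (mulIf C_neq0); rewrite mulrAC eABD mulrAC -eAD.
by rewrite mulrAC.
Qed.

(** Exchangeability reindexes the sum by the action on networks. *)
Lemma margin_perm s S x : exchangeable P ->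
  margin (dyad_perm s @: S) x = margin S [ffun d => x (dyad_perm s d)].
Proof.
move=> exch; rewrite /margin /prob.
pose act t y : network N := [ffun d => y (dyad_perm t d)].
have actK t : cancel (act t) (act t^-1)%g.
  by move=> y; apply/ffunP=> d; rewrite !ffunE dyad_permM mulVg dyad_perm1.
have actVK t : cancel (act t^-1)%g (act t).
  by move=> y; apply/ffunP=> d; rewrite !ffunE dyad_permM mulgV dyad_perm1.
rewrite (reindex (act s^-1)%g); last first.
  by exists (act s) => y _; [apply: actVK|apply: actK].
apply: eq_big => [y|y _]; last by rewrite -exch.
rewrite !agreeE; apply/forall_inP/forall_inP => eqy d dS.
  have := eqy _ (imset_f (dyad_perm s) dS).
  by rewrite !ffunE dyad_permM mulgV dyad_perm1.
case/imsetP: dS => {}d dS ->.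
by have := eqy _ dS; rewrite !ffunE dyad_permM mulgV dyad_perm1.
Qed.

Lemma ci_perm s A B C : exchangeable P -> ci P A B C ->
  ci P (dyad_perm s @: A) (dyad_perm s @: B) (dyad_perm s @: C).
Proof.
move=> exch /ciP ciABC; apply/ciP=> x.
by rewrite -!imsetU !margin_perm.
Qed.

End ConditionalIndependence.

(** * Models on dyads in which dyads sharing a node are independent *)

Section IncidenceComplement.
Variable N : finType.
Implicit Types (a b c i j k : N) (S : {set N}).
Implicit Types (u v x y : dyad N) (A B C W : {set dyad N}).
Notation e := (incidence_compl N).

Lemma incidence_compl_sym : symmetric e.
Proof. by move=> u v; rewrite /incidence_compl eq_sym disjoint_sym. Qed.

(** The complement of the incidence graph restricted to four nodes is a perfect
    matching: a dyad is adjacent only to the two remaining nodes. *)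
Lemma not_reach_within S W u v : (#|S| <= 4)%N -> W \subset dyads_within S ->
  u \in W -> u != v -> ~~ e u v -> ~~ reach e W u v.
Proof.
move=> leS4 sWS uW uv nuv; apply/negP.
pose Q x := x = u \/ [disjoint dyad_set u & dyad_set x].
suff Qstep x y : Q x -> e x y -> x \in W -> y \in W -> Q y.
  move/(reach_ind (or_introl erefl : Q u) Qstep) => [vu|duv].
    by rewrite vu eqxx in uv.
  by rewrite /incidence_compl uv duv in nuv.
move=> Qx /andP[_ dxy] xW yW; case: Qx => [xu|dux].
  by right; rewrite -xu.
left; apply: val_inj; apply/eqP => /=.
have inS z : z \in W -> dyad_set z \subset S.
  by move/(subsetP sWS); rewrite inE.
have SE : dyad_set u :|: dyad_set x = S.
  apply/eqP; rewrite eqEcard subUset !inS //=; apply: leq_trans leS4 _.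
  by rewrite cardsU disjoint_setI0 // cards0 !(eqP (card_dyad _)).
rewrite eqEcard !(eqP (card_dyad _)) leqnn andbT.
have := inS y yW; rewrite -SE => sy.
(* Only the three node sets matter from here on. *)
set U := dyad_set u in sy *; set X := dyad_set x in dxy sy *.
set Y := dyad_set y in dxy sy *.
by clear -dxy sy; set_tac.
Qed.

Variable I : {set dyad N} -> {set dyad N} -> {set dyad N} -> bool.
Hypotheses (modI : independence_model I) (compI : compositional I).
Hypothesis (invI : perm_invariant I).
Variables (i j k : N) (hij : i != j) (hik : i != k) (hjk : j != k).
Local Notation ij := (dyad_of hij).
Local Notation ik := (dyad_of hik).

Lemma sharing_dyads_transitive S u v : [set i; j; k] \subset S ->
  u \in dyads_within S -> v \in dyads_within S -> u != v -> ~~ e u v ->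
  exists s, [/\ perm_on S s, dyad_perm s ij = u & dyad_perm s ik = v].
Proof.
move=> sS uS vS uv nuv.
have [a [b [c [hab [hac [hbc uE vE]]]]]] := sharing_dyads uv nuv.
move: uS vS; rewrite uE vE !within_dyad_of => /andP[aS bS] /andP[_ cS].
have sabc : [set a; b; c] \subset S by rewrite !subUset !sub1set aS bS.
have [s [onS si sj sk]] := perm_on3 hij hik hjk hab hac hbc sS sabc.
exists s; split=> //; apply: val_inj => /=.
  by rewrite imsetU1 imset_set1 si sj.
by rewrite imsetU1 imset_set1 si sk.
Qed.

Lemma within_perm_on S s : perm_on S s ->
  dyad_perm s @: dyads_within S = dyads_within S.
Proof. by move=> onS; rewrite dyads_within_perm im_perm_on. Qed.

Lemma ij_neq_ik : ij != ik.
Proof.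
apply/eqP=> /(congr1 (fun d : dyad N => j \in dyad_set d)).
by rewrite /= !inE eqxx orbT eq_sym (negPf hij) (negPf hjk).
Qed.

Lemma ij_ik_nonadjacent : ~~ e ij ik.
Proof.
rewrite /incidence_compl ij_neq_ik; apply/pred0Pn; exists i.
by rewrite /= !inE eqxx.
Qed.

(** Conditioning on everything outside a set [S] of at most four nodes leaves
    all pairs sharing a node independent, by symmetry; composition then adds
    the remaining dyads of [S] to the conditioning set, since [ij] and [ik]
    are not connected inside [S]. *)
Lemma ind_given_rest S : [set i; j; k] \subset S -> (#|S| <= 4)%N ->
  I [set ij] [set ik] (~: dyads_within S) ->
  I [set ij] [set ik] (~: [set ij; ik]).
Proof.
move=> sS leS4 Iijk.
have [iS jS kS] : [/\ i \in S, j \in S & k \in S].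
  by split; apply: (subsetP sS); rewrite !inE eqxx ?orbT.
have ijS : ij \in dyads_within S by rewrite within_dyad_of iS.
have ikS : ik \in dyads_within S by rewrite within_dyad_of iS.
have sijik : [set ij; ik] \subset dyads_within S by rewrite subUset !sub1set ijS.
apply: (pairwise_to_global modI compI (Z := ~: dyads_within S)
          incidence_compl_sym) => //.
- move=> u v uv; rewrite !in_setC !negbK => uS vS nuv.
  have [s [onS <- <-]] := sharing_dyads_transitive sS uS vS uv nuv.
  by have := invI s Iijk; rewrite !imset_set1 dyad_permC within_perm_on.
- exact: ij_neq_ik.
- by rewrite !inE eqxx.
- by rewrite !inE eqxx orbT.
- by set_tac.
apply: (not_reach_within leS4) ij_neq_ik ij_ik_nonadjacent; first by set_tac.
by rewrite !inE eqxx orbT.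
Qed.

(** By composition, [ij] is independent of the star of [i] in [S] given the
    dyads of [S] that avoid [i]; weak union moves that star into the
    conditioning set. *)
Lemma ind_given_rest_within S : [set i; j; k] \subset S ->
  I [set ij] [set ik] (dyads_within (S :\ i)) ->
  I [set ij] [set ik] (dyads_within S :\: [set ij; ik]).
Proof.
move=> sS Iijk.
have [iS jS kS] : [/\ i \in S, j \in S & k \in S].
  by split; apply: (subsetP sS); rewrite !inE eqxx ?orbT.
pose star := [set d in dyads_within S | (i \in dyad_set d) && (d != ij)].
have SiE d : (d \in dyads_within (S :\ i)) =
    (d \in dyads_within S) && (i \notin dyad_set d).
  by rewrite !inE subsetD1.
have ij_star : ij \notin star by rewrite inE eqxx !andbF.
have ik_star : ik \in star.
  by rewrite inE within_dyad_of iS kS eq_sym ij_neq_ik andbT !inE eqxx.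
have dj_star : disjoint_sets [:: [set ij]; star; dyads_within (S :\ i)].
  rewrite /disjoint_sets /= !andbT !disjoints1 ij_star SiE /= !inE eqxx andbF.
  apply/disjointPx=> d; rewrite SiE !inE.
  by case: (i \in dyad_set d); rewrite !(andbT, andbF).
have Istar : I [set ij] star (dyads_within (S :\ i)).
  apply/(ind_pointwise modI compI) => // u v /set1P->.
  rewrite inE => /andP[vS /andP[iv v_neq]].
  have nuv : ~~ e ij v.
    rewrite /incidence_compl eq_sym v_neq; apply/pred0Pn; exists i.
    by rewrite /= iv !inE eqxx.
  rewrite eq_sym in v_neq.
  have [a [b [c [hab [hac [hbc ijE vE]]]]]] := sharing_dyads v_neq nuv.
  have ai : a = i.
    have := iv; rewrite vE /= !inE => /orP[]/eqP // ic.
    have : c \in dyad_set (dyad_of hab) by rewrite -ijE /= -ic !inE eqxx.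
    by rewrite /= !inE eq_sym (negPf hac) eq_sym (negPf hbc).
  subst a; have bj : b = j.
    have : b \in dyad_set ij by rewrite ijE /= !inE eqxx orbT.
    by rewrite /= !inE eq_sym (negPf hab) => /eqP.
  subst b; have cS : c \in S by move: vS; rewrite vE within_dyad_of => /andP[].
  have hic : i != c by [].
  have := invI (tperm k c) Iijk; rewrite !imset_set1 within_perm_on; last first.
    apply: subset_trans (tperm_on k c) _; apply/subsetP=> z; rewrite !inE.
    by case/orP=> /eqP->; rewrite ?kS ?cS eq_sym ?hik ?hic.
  have ti : tperm k c i = i by rewrite tpermD // eq_sym.
  have tj : tperm k c j = j by rewrite tpermD // eq_sym.
  have hsij : tperm k c i != tperm k c j by rewrite ti tj.
  have hsik : tperm k c i != tperm k c k by rewrite ti tpermL.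
  rewrite (dyad_perm_of _ hsij) (dyad_perm_of _ hsik).
  have -> : dyad_of hsij = ij by apply: val_inj; rewrite /= ti tj.
  by have -> : dyad_of hsik = v
    by rewrite vE; apply: val_inj; rewrite /= ti tpermL.
have -> : dyads_within S :\: [set ij; ik] =
    dyads_within (S :\ i) :|: (star :\ ik).
  apply/setP=> d; rewrite in_setD in_set2 in_setU SiE in_setD1 [d \in star]inE.
  have [->|_] := eqVneq d ij; first by rewrite /= !inE eqxx !andbF.
  have [->|_] := eqVneq d ik; first by rewrite /= !inE eqxx !andbF.
  by case: (d \in _); case: (i \in _).
have sik : [set ik] \subset star by rewrite sub1set.
apply: (ind_weak_union modI); first by set_tac.
by rewrite setUC setUC (setD1K ik_star).
Qed.

(** For a pair sharing a node, the second-to-last hypothesis, transported by a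
    node permutation, turns independence into separation, and the last one is
    the pairwise Markov property from which separation yields independence. The
    latter runs through the dual because intersection is composition for it. *)
Lemma faithful_incidence_compl : intersective I ->
  (forall u v C, e u v -> u \notin C -> v \notin C -> ~~ I [set u] [set v] C) ->
  (forall C, ij \notin C -> ik \notin C -> I [set ij] [set ik] C ->
     exists S, (#|S| <= 4)%N /\ ~: dyads_within S \subset C) ->
  I [set ij] [set ik] (~: [set ij; ik]) ->
  faithful_to I e.
Proof.
move=> intI depI smallI Irest.
have moves_to u v : u != v -> ~~ e u v ->
    exists s, dyad_perm s ij = u /\ dyad_perm s ik = v.
  have inT d : d \in dyads_within [set: N] by rewrite inE subsetT.
  move=> uv nuv.
  have [s [_ su sv]] := sharing_dyads_transitive (subsetT _) (inT u) (inT v) uv nuv.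
  by exists s.
have pairE u v C : u != v -> u \notin C -> v \notin C ->
    ~~ reach e (~: C) u v <-> I [set u] [set v] C.
  move=> uv uC vC; have [euv|nuv] := boolP (e u v).
    have ruv : reach e (~: C) u v by apply: reach1; rewrite // inE.
    by split=> [|Iuv]; [rewrite ruv|have /negP[] := depI u v C euv uC vC].
  split=> [sep|Iuv].
    have dualI : dual I [set u] [set v] (~: ([set u] :|: [set v] :|: C)).
      apply: (pairwise_to_global (dual_model modI) _ (Z := set0)
                incidence_compl_sym) => //.
      - by apply/dual_composition.
      - move=> x y xy _ _ nxy; have [s [<- <-]] := moves_to x y xy nxy.
        rewrite /dual setU0; have := invI s Irest.
        by rewrite dyad_permC imsetU !imset_set1.
      - by rewrite !inE eqxx.
      - by rewrite !inE eqxx orbT.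
      - exact: sub0set.
      apply: contra sep; apply: reach_sub; set_tac.
    move: dualI; rewrite /dual; congr (I _ _ _); set_tac.
  have [s [su sv]] := moves_to u v uv nuv.
  have := invI s^-1%g Iuv; rewrite -su -sv !imset_set1 !dyad_permK => Iijk.
  have memV d : (d \in dyad_perm s^-1 @: C) = (dyad_perm s d \in C).
    by rewrite (can_imset_pre _ (dyad_permKV s)) inE.
  have [||S [leS4 sSC]] := smallI _ _ _ Iijk; rewrite ?memV ?su ?sv //.
  apply: (@not_reach_within (s @: S)) => //.
  - by rewrite card_imset //; apply: perm_inj.
  - rewrite -dyads_within_perm -setCS setCK -dyad_permC.
    apply/subsetP=> _ /imsetP[d dS ->].
    by rewrite -memV (subsetP sSC).
  - by rewrite inE.
move=> A B C dj; rewrite (ind_pointwise modI compI dj).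
have pairABC u v : u \in A -> v \in B -> [/\ u != v, u \notin C & v \notin C].
  move=> uA vB; have su : [set u] \subset A by rewrite sub1set.
  have sv : [set v] \subset B by rewrite sub1set.
  by rewrite -in_set1 -!disjoints1; split; set_tac.
split=> [/separatedP sep u v uA vB|Iuv].
  by have [uv uC vC] := pairABC u v uA vB; apply/pairE => //; apply: sep.
apply/separatedP=> u v uA vB; have [uv uC vC] := pairABC u v uA vB.
by apply/pairE => //; apply: Iuv.
Qed.

End IncidenceComplement.

(** * Shapes of the minimal and maximal conditioning sets *)

Section Shapes.
Variable N : finType.
Implicit Types (a b m x y : N) (S : {set N}) (d : dyad N) (C : {set dyad N}).

(** A set of dyads seen as a graph on the nodes, without proofs that the ends of
    an edge differ. *)
Definition edge C a b := [exists d in C, dyad_set d == [set a; b]].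

Lemma edge_dyad_of C a b (hab : a != b) : edge C a b = (dyad_of hab \in C).
Proof.
apply/exists_inP/idP => [[d dC /eqP dE]|habC]; last by exists (dyad_of hab).
by have <- : d = dyad_of hab by apply: val_inj.
Qed.

Lemma edge_sym C a b : edge C a b = edge C b a.
Proof. by rewrite /edge setUC. Qed.

Lemma edge_neq C a b : edge C a b -> a != b.
Proof.
case/exists_inP=> d _ /eqP dE; apply: contraTneq (card_dyad d) => ab.
by rewrite dE ab setUid cards1.
Qed.

Lemma edge_swap k m C a b : swap_invariant k m C ->
  edge C (tperm k m a) (tperm k m b) = edge C a b.
Proof.
have swap_edge x y : edge C x y ->
    edge (dyad_perm (tperm k m) @: C) (tperm k m x) (tperm k m y).
  case/exists_inP=> d dC /eqP dE; apply/exists_inP.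
  exists (dyad_perm (tperm k m) d); first exact: imset_f.
  by rewrite /= dE imsetU1 imset_set1.
move=> inv; apply/idP/idP => /swap_edge; rewrite inv //.
by rewrite !tpermK.
Qed.

Variables (i j k : N) (hij : i != j) (hik : i != k) (hjk : j != k).
Local Notation ij := (dyad_of hij).
Local Notation ik := (dyad_of hik).

(** Invariance under swapping makes [a] and [k] twins. *)
Lemma edge_swapped C a b : swap_invariant k a C -> b != a -> b != k ->
  edge C a b = edge C k b.
Proof.
move=> inv ba bk; rewrite -(edge_swap _ _ inv) tpermR.
by rewrite tpermD // eq_sym.
Qed.

Lemma avoiding_dyad_of a b (hab : a != b) :
  (dyad_of hab \in dyads_avoiding i j k) =
  (a \notin [set i; j; k]) && (b \notin [set i; j; k]).
Proof. by rewrite inE disjoints_subset subUset !sub1set !in_setC. Qed.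

(** Take for [S] the non-neighbours of [k], including [k]. Those other than [k]
    lie on a missing dyad, hence are twins of [k]; so [S] spans no edge, while
    all edges between [S] and the rest are present. Two nodes of [S] other than
    [i], [j], [k] would be joined by a dyad of [dyads_avoiding i j k], so there
    is at most one. *)
Lemma minimal_shape C : ij \notin C -> ik \notin C ->
  dyads_avoiding i j k \subset C ->
  (forall m, (exists (l : N) (hlm : l != m), dyad_of hlm \notin C) ->
     swap_invariant k m C) ->
  exists S, [/\ [set i; j; k] \subset S, (#|S| <= 4)%N & C = ~: dyads_within S].
Proof.
move=> ijC ikC avC swapC; pose S := [set x | ~~ edge C k x].
have kS : k \in S by rewrite inE; apply/negP=> /edge_neq; rewrite eqxx.
have nbrS a b : a \in S -> b != a -> b != k -> edge C a b = edge C k b.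
  have [-> //|ak aS] := eqVneq a k; apply: edge_swapped; apply: swapC.
  rewrite eq_sym in ak; exists k, ak; move: aS.
  by rewrite inE (edge_dyad_of _ ak).
have iS : i \in S by rewrite inE edge_sym (edge_dyad_of _ hik).
have jS : j \in S.
  by rewrite inE -(nbrS i) // 1?eq_sym // (edge_dyad_of _ hij).
have sijk : [set i; j; k] \subset S by rewrite !subUset !sub1set iS jS.
have avoid a b : a != b -> a \notin [set i; j; k] -> b \notin [set i; j; k] ->
    edge C a b.
  move=> hab na nb; rewrite (edge_dyad_of _ hab) (subsetP avC) //.
  by rewrite avoiding_dyad_of na.
exists S; split=> //.
  rewrite -(cardsID [set i; j; k]) -[4%N]/(3 + 1)%N; apply: leq_add.
    apply: leq_trans (subset_leq_card (subsetIr _ _)) _.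
    apply: leq_trans (leq_card_setU _ _) _.
    by rewrite cards1 cards2 hij.
  apply/card_le1_eqP => y x /setDP[yS ny] /setDP[xS nx].
  apply/eqP/negPn/negP => hxy; have := avoid x y hxy nx ny.
  rewrite nbrS // 1?eq_sym //; first by apply/negP; rewrite inE in yS.
  by apply: contraNneq ny => ->; rewrite !inE eqxx orbT.
apply/setP=> d; rewrite in_setC; have [a [b [hab ->]]] := dyadP d.
rewrite within_dyad_of -edge_dyad_of.
have half x y : x != y -> x \in S -> edge C x y = (y \notin S).
  move=> xy xS; have [yk|yk] := eqVneq y k.
    by rewrite yk kS edge_sym; apply: negbTE; rewrite inE in xS.
  by rewrite nbrS // 1?eq_sym // [y \in S]inE negbK.
have [aS|aS] := boolP (a \in S); first exact: half.
have [bS|bS] := boolP (b \in S).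
  by rewrite edge_sym half 1?eq_sym.
by apply: avoid => //; [apply: contra aS|apply: contra bS]; apply: (subsetP sijk).
Qed.

(** Take for [S] the closed neighbourhood of [k]. Its nodes are twins of [k], so
    that [S] is a clique with no edge to the outside. A node [b] on an edge [ab]
    is also a twin of [k], so that [a] is a neighbour of [k]: no edge lies
    outside [S]. Two nodes of the clique other than [j] and [k] would span a
    dyad of [dyads_avoiding i j k], which [C] misses. *)
Lemma maximal_shape C : ij \notin C -> ik \notin C ->
  dyads_avoiding i j k :&: C = set0 ->
  (forall m, (exists (l : N) (hlm : l != m), dyad_of hlm \in C) ->
     swap_invariant k m C) ->
  exists S, [/\ k \in S, i \notin S, (#|S :\: [set j; k]| <= 1)%N &
                C = dyads_within S].
Proof.
move=> ijC ikC avC swapC; pose S := [set x | edge C k x || (x == k)].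
have kS : k \in S by rewrite inE eqxx orbT.
have swap a b : edge C a b -> swap_invariant k b C.
  move=> ab; have hab := edge_neq ab; apply: swapC; exists a, hab.
  by rewrite -edge_dyad_of.
have nbrS a b : a \in S -> b != a -> b != k -> edge C a b = edge C k b.
  rewrite inE => /orP[/swap|/eqP-> //]; exact: edge_swapped.
have iS : i \notin S.
  by rewrite inE edge_sym (edge_dyad_of _ hik) (negPf ikC) (negPf hik).
exists S; split=> //.
  apply/card_le1_eqP => y x; rewrite !inE !negb_or => /andP[/andP[yj yk] yS].
  move=> /andP[/andP[xj xk] xS]; apply/eqP/negPn/negP => hxy.
  have inS z : edge C k z || (z == k) -> z != i.
    by move=> zS; apply: contraNneq iS => <-; rewrite inE.
  have : dyad_of hxy \in dyads_avoiding i j k :&: C.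
    rewrite in_setI avoiding_dyad_of !inE !negb_or xj xk yj yk !inS //=.
    rewrite -edge_dyad_of nbrS // 1?eq_sym ?inE //.
    by move: yS; rewrite (negPf yk) orbF.
  by rewrite avC inE.
apply/setP=> d; have [a [b [hab ->]]] := dyadP d.
rewrite within_dyad_of -edge_dyad_of.
have half x y : x != y -> x \in S -> edge C x y = (y \in S).
  move=> xy xS; have [yk|yk] := eqVneq y k.
    by rewrite yk kS edge_sym; move: xS; rewrite inE -yk (negPf xy) orbF.
  by rewrite nbrS // 1?eq_sym // inE (negPf yk) orbF.
have [aS|aS] := boolP (a \in S); first exact: half.
have [bS|bS] := boolP (b \in S).
  by rewrite edge_sym half 1?eq_sym // (negPf aS).
apply: contraNF aS => ab; have ak : a != k.
  by apply: contraNneq bS => ak; rewrite inE -ak ab.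
rewrite inE -(edge_swapped (swap _ _ ab)) // 1?eq_sym //.
by rewrite edge_sym ab.
Qed.

End Shapes.

(** * Exchangeable networks *)

Section ExchangeableNetworks.
Variables (R : realType) (N : finType) (P : network N -> R).
Implicit Types (S : {set N}) (u v d : dyad N) (A B C : {set dyad N}).
Notation e := (incidence_compl N).

Lemma undirected_faithfulE (G : rel (dyad N)) :
  undirected_faithful P G <-> faithful_to (ci P) G.
Proof.
split=> fP A B C dj; first by rewrite -undirected_sepE //; apply: fP.
by rewrite undirected_sepE //; apply: fP.
Qed.

Lemma bidirected_faithfulE (G : rel (dyad N)) :
  bidirected_faithful P G <-> faithful_to (dual (ci P)) G.
Proof.
split=> fP A B C dj.
  have djC : disjoint_sets [:: A; B; ~: (A :|: B :|: C)] by set_tac.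
  rewrite -(fP A B _ djC) bidirected_sepE.
  by have -> : ~: (A :|: B :|: ~: (A :|: B :|: C)) = C by set_tac.
have {}dj : disjoint_sets [:: A; B; C] by [].
have djC : disjoint_sets [:: A; B; ~: (A :|: B :|: C)] by set_tac.
rewrite bidirected_sepE (fP A B _ djC) /dual.
by have -> : ~: (A :|: B :|: ~: (A :|: B :|: C)) = C by set_tac.
Qed.

Hypotheses (hP : distribution P) (hexch : exchangeable P).
Hypothesis hsk : skeleton P =2 e.

Let P_ge0 : forall x, 0 <= P x := proj1 hP.
Let ciM : independence_model (ci P) := ci_model P_ge0.

Let ci_inv : perm_invariant (ci P).
Proof. by move=> s A B C; apply: ci_perm. Qed.

Lemma adjacent_dependent u v C : e u v -> u \notin C -> v \notin C ->
  ~~ ci P [set u] [set v] C.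
Proof.
rewrite -hsk => /andP[_ /existsPn/(_ C)] + uC vC.
by rewrite uC vC.
Qed.

Lemma sharing_separable u v : u != v -> ~~ e u v ->
  exists C, [/\ u \notin C, v \notin C & ci P [set u] [set v] C].
Proof.
rewrite -hsk /skeleton => -> /= /negPn/existsP[C /and3P[uC vC uvC]].
by exists C.
Qed.

Variables (i j k : N) (hij : i != j) (hik : i != k) (hjk : j != k).
Local Notation ij := (dyad_of hij).
Local Notation ik := (dyad_of hik).

Let indep C := [&& ij \notin C, ik \notin C & ci P [set ij] [set ik] C].

Lemma minset_minimal_ci C : minset indep C -> minimal_ci P ij ik C.
Proof.
case/minsetP=> /and3P[ijC ikC ciC] minC; split=> // d dC.
apply: contraL dC => ciCd; rewrite -(minC (C :\ d)) ?subD1set ?inE ?eqxx //.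
by rewrite /indep !inE !negb_and ijC ikC !orbT.
Qed.

Lemma maxset_maximal_ci C : maxset indep C -> maximal_ci P ij ik C.
Proof.
case/maxsetP=> /and3P[ijC ikC ciC] maxC; split=> // d dC dij dik.
apply: contra dC => ciCd; rewrite -(maxC (d |: C)) ?subsetU1 ?setU11 //.
by rewrite /indep !inE !negb_or ijC ikC ![_ == d]eq_sym dij dik.
Qed.

Let tau := dyad_perm (tperm j k).

Lemma tauK : involutive tau.
Proof. by move=> d; rewrite /tau -{1}(tpermV j k) dyad_permK. Qed.

Lemma indep_tau C : indep C -> indep (tau @: C).
Proof.
have ti : tperm j k i = i by rewrite tpermD // eq_sym.
have tij : tau ij = ik.
  by apply: val_inj; rewrite /= imsetU1 imset_set1 ti tpermL.
have tik : tau ik = ij by rewrite -tij tauK.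
case/and3P=> ijC ikC ciC; apply/and3P; split.
- by rewrite -tik (mem_imset _ _ (can_inj tauK)).
- by rewrite -tij (mem_imset _ _ (can_inj tauK)).
have := ci_perm P_ge0 (tperm j k) hexch ciC.
rewrite !imset_set1 -/tau tij tik; apply: (ind_sym ciM).
have ikC' : ik \notin tau @: C by rewrite -tij (mem_imset _ _ (can_inj tauK)).
have ijC' : ij \notin tau @: C by rewrite -tik (mem_imset _ _ (can_inj tauK)).
have := ij_neq_ik hij hik hjk => neq.
by set_tac.
Qed.

Lemma tau_tau C : tau @: (tau @: C) = C.
Proof. by rewrite -imset_comp (eq_imset _ tauK) imset_id. Qed.

(** [tau] swaps [ij] and [ik], and independence is symmetric. *)
Lemma maxset_tau C : maxset indep C -> maxset indep (tau @: C).
Proof.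
case/maxsetP=> indC maxC; apply/maxsetP; split; first exact: indep_tau.
move=> B indB sCB; rewrite -(maxC (tau @: B)) ?tau_tau //.
  exact: indep_tau.
by rewrite -[C]tau_tau imsetS.
Qed.

Lemma undirected_faithful_iff :
  (forall C, minimal_ci P ij ik C ->
     dyads_avoiding i j k \subset C /\
     (forall m : N, (exists (l : N) (hlm : l != m), dyad_of hlm \notin C) ->
        swap_invariant k m C)) ->
  undirected_faithful P e <-> intersection_property P /\ composition_property P.
Proof.
move=> minH; rewrite undirected_faithfulE; split=> [fP|[intP compP]].
  by split; [apply: faithful_intersection fP|apply: faithful_composition fP].
have shape C : indep C -> exists S,
    [/\ [set i; j; k] \subset S, (#|S| <= 4)%N, ~: dyads_within S \subset C &
        ci P [set ij] [set ik] (~: dyads_within S)].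
  case/minset_exists=> C' minC' sC'C.
  have [avC swapC] := minH _ (minset_minimal_ci minC').
  have /and3P[ijC ikC ciC] := minsetp minC'.
  have [S [sS leS4 C'E]] := minimal_shape hjk ijC ikC avC swapC.
  by exists S; rewrite -C'E.
apply: (faithful_incidence_compl ciM compP ci_inv hjk (hij := hij) (hik := hik)) => //.
- exact: adjacent_dependent.
- move=> C ijC ikC ciC; have [|S [_ leS4 sSC _]] := shape C; last by exists S.
  by rewrite /indep ijC ikC.
have [C [ijC ikC ciC]] := sharing_separable (ij_neq_ik hij hik hjk) (ij_ik_nonadjacent hij hik hjk).
have [|S [sS leS4 _ ciS]] := shape C; first by rewrite /indep ijC ikC.
exact: (ind_given_rest ciM compP ci_inv hjk sS leS4 ciS).
Qed.

Lemma bidirected_faithful_iff :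
  (forall C, maximal_ci P ij ik C ->
     dyads_avoiding i j k :&: C = set0 /\
     (forall m : N, (exists (l : N) (hlm : l != m), dyad_of hlm \in C) ->
        swap_invariant k m C)) ->
  bidirected_faithful P e <-> intersection_property P /\ composition_property P.
Proof.
move=> maxH; rewrite bidirected_faithfulE; split=> [fP|[intP compP]].
  split; first by apply/dual_composition; apply: faithful_composition fP.
  by apply/dual_intersection; apply: faithful_intersection fP.
have dM := dual_model ciM; have d_inv := dual_perm_invariant ci_inv.
have dcomp : compositional (dual (ci P)) by apply/dual_composition.
have dint : intersective (dual (ci P)) by apply/dual_intersection.
have shape C : maxset indep C -> exists S,
    [/\ k \in S, i \notin S, (#|S :\: [set j; k]| <= 1)%N & C = dyads_within S].
  move=> maxC; have [avC swapC] := maxH _ (maxset_maximal_ci maxC).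
  have /and3P[ijC ikC _] := maxsetp maxC.
  exact: (maximal_shape ijC ikC avC swapC).
have extend (S : {set N}) : k \in S -> (#|S :\: [set j; k]| <= 1)%N ->
    [set i; j; k] \subset i |: (j |: S) /\ (#|i |: (j |: S)| <= 4)%N.
  move=> kS leS; split.
    by apply/subsetP=> x; rewrite !inE => /orP[/orP[]|] /eqP->; rewrite ?eqxx ?kS ?orbT.
  have -> : i |: (j |: S) = [set i; j; k] :|: (S :\: [set j; k]).
    apply/setP=> x; rewrite !inE; have [->|_] := eqVneq x i => //.
    by have [->|_] := eqVneq x j => //; have [->|_] := eqVneq x k.
  apply: leq_trans (leq_card_setU _ _) _; rewrite -[4%N]/(3 + 1)%N leq_add //.
  by apply: leq_trans (leq_card_setU _ _) _; rewrite cards1 cards2 hij.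
have dualE C : disjoint_sets [:: [set ij]; [set ik]; C] ->
    dual (ci P) [set ij] [set ik] (~: ([set ij] :|: [set ik] :|: C)) =
    ci P [set ij] [set ik] C.
  by move=> dj; rewrite /dual; congr ci; set_tac.
have djC C : ij \notin C -> ik \notin C ->
    disjoint_sets [:: [set ij]; [set ik]; C].
  by have := ij_neq_ik hij hik hjk => neq ijC ikC; set_tac.
apply: (faithful_incidence_compl dM dcomp d_inv hjk (hij := hij) (hik := hik)) => //.
- move=> u v C euv uC vC; apply: adjacent_dependent => //.
    by rewrite !inE eqxx.
  by rewrite !inE eqxx orbT.
- move=> C ijC ikC; rewrite /dual => ciC.
  have [|C' maxC' sC'] := @maxset_exists _ indep (~: ([set ij] :|: [set ik] :|: C)).
    by rewrite /indep !inE !eqxx orbT.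
  have [S [kS iS leS C'E]] := shape C' maxC'.
  have [sS leS4] := extend S kS leS; exists (i |: (j |: S)); split=> //.
  apply/subsetP=> d; rewrite in_setC; apply: contraNT => dC.
  have [->|dij] := eqVneq d ij; first by rewrite within_dyad_of !inE !eqxx ?orbT.
  have [->|dik] := eqVneq d ik.
    by rewrite within_dyad_of !inE !eqxx kS ?orbT.
  have : d \in C' by rewrite (subsetP sC') // !inE (negPf dij) (negPf dik).
  rewrite C'E !inE => sdS; apply: subset_trans sdS _.
  by rewrite setUA subsetUr.
have [C [ijC ikC ciC]] := sharing_separable (ij_neq_ik hij hik hjk) (ij_ik_nonadjacent hij hik hjk).
have [|C' maxC' _] := @maxset_exists _ indep C; first by rewrite /indep ijC ikC.
have /and3P[ijC' ikC' ciC'] := maxsetp maxC'.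
have [S [kS iS leS C'E]] := shape C' maxC'.
have [jS|jS] := boolP (j \in S).
  have [sS leS4] := extend S kS leS.
  have jSE : j |: S = S by apply/setUidPr; rewrite sub1set.
  rewrite jSE in sS leS4.
  have ci_rest : ci P [set ij] [set ik] (dyads_within (i |: S) :\: [set ij; ik]).
    by apply: (ind_given_rest_within ciM compP ci_inv hjk sS); rewrite setU1K // -C'E.
  apply: (ind_given_rest dM dcomp d_inv hjk sS leS4).
  rewrite -dualE in ci_rest; last by apply: djC; rewrite !inE eqxx ?orbT.
  move: ci_rest; congr (dual _ _ _ _).
  have iiS : i \in i |: S by rewrite setU11.
  have ijS : ij \in dyads_within (i |: S) by rewrite within_dyad_of iiS inE jS orbT.
  have ikS : ik \in dyads_within (i |: S) by rewrite within_dyad_of iiS inE kS orbT.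
  rewrite -!sub1set in ijS ikS; set_tac.
(* Otherwise [S] has no node but [k]: were [m] another one, [jm] would belong
   to the mirror image of [C'] under swapping [j] and [k], which is complete
   on a set of nodes containing [k]; so [km] would belong to it as well, and
   [jm] to [C'], although [j] is not in [S]. *)
have C'0 : C' = set0.
  have [S2 [kS2 _ _ tC'E]] := shape _ (maxset_tau maxC').
  have im_S : dyads_within S2 = dyads_within (tperm j k @: S).
    by rewrite -tC'E C'E /tau dyads_within_perm.
  apply/eqP; apply: contraNT jS => /set0Pn[d]; rewrite C'E.
  have [a [b [hab ->]]] := dyadP d; rewrite within_dyad_of => /andP[aS bS].
  have [m [mS mk]] : exists m, m \in S /\ m != k.
    have [ak|ak] := eqVneq a k; last by exists a.
    by exists b; split=> //; rewrite eq_sym -ak.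
  have [<- //|mj] := eqVneq m j.
  have inj x : (x \in tperm j k @: S) = (tperm j k x \in S).
    by rewrite (can_imset_pre _ (tpermK j k)) inE.
  have tm : tperm j k m = m by rewrite tpermD // eq_sym.
  have mS2 : m \in S2.
    have : dyad_of mj \in dyads_within S2.
      by rewrite im_S within_dyad_of !inj tm tpermL mS.
    by rewrite within_dyad_of => /andP[].
  have : dyad_of mk \in dyads_within S2 by rewrite within_dyad_of mS2.
  by rewrite im_S within_dyad_of !inj tpermR => /andP[].
rewrite -[set1 ij :|: set1 ik]setU0 dualE -?C'0 //.
by apply: djC.
Qed.

End ExchangeableNetworks.

Theorem theorem4 (R : realType) (N : finType) (P : network N -> R)
  (hP : distribution P) (hexch : exchangeable P)
  (hsk : skeleton P =2 incidence_compl N)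
  (i j k : N) (hij : i != j) (hik : i != k) (hjk : j != k) :
  ((forall C : {set dyad N},
      minimal_ci P (dyad_of hij) (dyad_of hik) C ->
      dyads_avoiding i j k \subset C /\
      (forall m : N,
         (exists (l : N) (hlm : l != m), dyad_of hlm \notin C) ->
         swap_invariant k m C)) ->
   (undirected_faithful P (incidence_compl N) <->
    intersection_property P /\ composition_property P))
  /\
  ((forall C : {set dyad N},
      maximal_ci P (dyad_of hij) (dyad_of hik) C ->
      dyads_avoiding i j k :&: C = set0 /\
      (forall m : N,
         (exists (l : N) (hlm : l != m), dyad_of hlm \in C) ->
         swap_invariant k m C)) ->
   (bidirected_faithful P (incidence_compl N) <->
    intersection_property P /\ composition_property P)).
Proof. by split; [apply: undirected_faithful_iff|apply: bidirected_faithful_iff]. Qed.
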